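(* For every even integer $n\geq 6$, $\Pi^{bichrom}(n)\geq \left\lceil \frac{n-2}{72}\right\rceil$. That is, for every simple polygon $P$ and every set $S$ in general position in $P$ of $n/2$ red and $n/2$ blue points, there exist a red point $r$ and a blue point $b$ of $S$ such that every geodesic disk through $r$ and $b$ contains at least $\left\lceil \frac{n-2}{72}\right\rceil$ points of $S$.
   Context: $P$ is a simple polygon (a closed region). For $a,b\in P$, $g(a,b)$ denotes the shortest (geodesic) path from $a$ to $b$ inside $P$ and $|g(a,b)|$ its length. A geodesic disk with center $c$ and radius $r$ is $D(c,r)=\{x\in P:|g(c,x)|\le r\}$; it is ''through'' some points if those points lie on its boundary (distance exactly $r$ from $c$), and contains a point if the point belongs to it. General position of $S$: no three points of $S$ are geodesically collinear (one on the geodesic path between the other two), no four points among $S$ and the vertices of $P$ lie on the boundary of a common geodesic disk, there are no $x,y\in S$ and reflex vertex $p$ of $P$ with $y\in g(x,p)$, and no geodesic bisector of two points of $S$ passes through a vertex of $P$. $\Pi^{bichrom}(n)$ is the largest integer such that for every simple polygon $P$ and every such set $S$ of $n/2$ red and $n/2$ blue points, there exist a red point $r$ and a blue point $b$ such that every geodesic disk through them contains at least $\Pi^{bichrom}(n)$ points of $S$. *)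

(* Defs.v *)
From HB Require Import structures.
From mathcomp Require Import all_boot all_order all_algebra.
From mathcomp Require Import all_classical all_reals all_analysis.
Set Implicit Arguments. Unset Strict Implicit. Unset Printing Implicit Defensive.
Import Order.TTheory GRing.Theory Num.Theory.
Import numFieldNormedType.Exports.
Local Open Scope classical_set_scope.
Local Open Scope ring_scope.

Section Geodesic.
Variable R : realType.
Local Notation pt := (R * R)%type.

Definition edist (p q : pt) : R :=
  Num.sqrt ((p.1 - q.1) ^+ 2 + (p.2 - q.2) ^+ 2).

Definition seg (a b : pt) : set pt :=
  [set p | exists t : R, 0 <= t <= 1 /\
     p = ((1 - t) * a.1 + t * b.1, (1 - t) * a.2 + t * b.2)].

Definition vtx (vs : seq pt) (i : nat) : pt := nth (0, 0) vs (i %% size vs).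
Definition edge (vs : seq pt) (i : nat) : set pt := seg (vtx vs i) (vtx vs i.+1).

Definition simple_polygon (vs : seq pt) : Prop :=
  [/\ (3 <= size vs)%N,
      (forall i, (i < size vs)%N -> vtx vs i <> vtx vs i.+1) &
      (forall i j, (i < j < size vs)%N ->
         if j == i.+1 then edge vs i `&` edge vs j = [set vtx vs j]
         else if (i == 0) && (j == (size vs).-1)
              then edge vs i `&` edge vs j = [set vtx vs 0]
              else edge vs i `&` edge vs j = set0)].

Definition boundary (vs : seq pt) : set pt :=
  \bigcup_(i in [set i : nat | (i < size vs)%N]) edge vs i.

Definition unbounded (A : set pt) : Prop :=
  forall M : R, exists y, A y /\ M < `|y.1| + `|y.2|.

(* The closed region P bounded by the polygon: boundary plus the bounded
   complementary components (i.e. everything not in an unbounded connected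
   component of the complement of the boundary). *)
Definition region (vs : seq pt) : set pt :=
  [set x | ~ (~ boundary vs x /\
              unbounded (connected_component (~` boundary vs) x))].

(* polygonal paths a -> s_1 -> ... -> s_k *)
Fixpoint plen (a : pt) (s : seq pt) : R :=
  if s is b :: s' then edist a b + plen b s' else 0.
Fixpoint pinside (P : set pt) (a : pt) (s : seq pt) : Prop :=
  if s is b :: s' then seg a b `<=` P /\ pinside P b s' else True.
Fixpoint ponpath (a : pt) (s : seq pt) (y : pt) : Prop :=
  if s is b :: s' then seg a b y \/ ponpath b s' y else y = a.

Definition gdist (P : set pt) (a b : pt) : R :=
  inf [set l | exists s, [/\ last a s = b, pinside P a s & l = plen a s]].

Definition on_geodesic (P : set pt) (x z y : pt) : Prop :=
  exists s, [/\ last x s = z, pinside P x s, plen x s = gdist P x z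
              & ponpath x s y].

Definition cross (p q : pt) : R := p.1 * q.2 - p.2 * q.1.
Definition psub (p q : pt) : pt := (p.1 - q.1, p.2 - q.2).

(* twice the signed area: > 0 iff counterclockwise orientation *)
Definition signed_area2 (vs : seq pt) : R :=
  \sum_(i < size vs) cross (vtx vs i) (vtx vs i.+1).

(* vertex i is reflex: interior angle > pi, i.e. it turns against the
   orientation of the polygon *)
Definition reflex_at (vs : seq pt) (i : nat) : Prop :=
  cross (psub (vtx vs i) (vtx vs (i + (size vs).-1)))
        (psub (vtx vs i.+1) (vtx vs i)) * signed_area2 vs < 0.

Definition reflex_vertex (vs : seq pt) (p : pt) : Prop :=
  exists2 i, (i < size vs)%N & p = vtx vs i /\ reflex_at vs i.

Definition general_position (vs : seq pt) (S : seq pt) : Prop :=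
  let P := region vs in
  [/\
      (forall x y z, x \in S -> y \in S -> z \in S -> uniq [:: x; y; z] ->
          ~ on_geodesic P x z y),
      (forall p1 p2 p3 p4, p1 \in S ++ vs -> p2 \in S ++ vs ->
          p3 \in S ++ vs -> p4 \in S ++ vs -> uniq [:: p1; p2; p3; p4] ->
          ~ exists c rho, [/\ P c, gdist P c p1 = rho, gdist P c p2 = rho,
                             gdist P c p3 = rho & gdist P c p4 = rho]),
      (forall x y p, x \in S -> y \in S -> x != y -> reflex_vertex vs p ->
          ~ on_geodesic P x p y) &
      (forall x y v, x \in S -> y \in S -> x != y -> v \in vs ->
          gdist P x v <> gdist P y v)].

Definition disk_count (vs : seq pt) (S : seq pt) (c : pt) (rho : R) : nat :=
  count (fun s => gdist (region vs) c s <= rho) S.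

End Geodesic.

(* Main.v *)
Require Import Defs.
From Stdlib Require Import Ring.
From HB Require Import structures.
From mathcomp Require Import all_boot all_order all_algebra.
From mathcomp Require Import all_classical all_reals all_analysis.
Set Implicit Arguments. Unset Strict Implicit. Unset Printing Implicit Defensive.
Import Order.TTheory GRing.Theory Num.Theory.
Import numFieldNormedType.Exports.
Local Open Scope classical_set_scope.
Local Open Scope ring_scope.

(** If every red-blue pair had a disk through it containing few points, averaging
    over triples would give three red points [r i] and three blue points [b j]
    such that, for all [i] and [j], some disk centered at a point [c i j] passes
    through [r i] and [b j] and contains none of the other four points.  Join
    [c i j] to [r i] and to [b j] by nearly shortest paths: a tail exchange shows
    that the resulting paths from [r i] to [b j] and from [r k] to [b l] are
    disjoint when [i <> k] and [j <> l], so [K_{3,3}] is drawn in the plane with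
    independent edges disjoint.

    Such a drawing is impossible by a parity count that needs no general
    position.  For disjoint paths [e] and [f] the difference [e(s) - f(t)] never
    vanishes, so its restriction to the boundary of the square of parameters
    crosses a fixed ray from the origin an even number of times.  The sides of
    that square are crossing parities of a path with the vertical ray from an
    endpoint of the other path; adding the relations of the 18 pairs of
    independent edges, all these parities cancel and [0 = 1] remains. *)

(** * Parity relations *)

Lemma addbE b c : b (+) c = xorb b c. Proof. by case: b; case: c. Qed.

(* The [ring] of [mathcomp], required later, does not handle [xorb]. *)
Ltac bool_ring := rewrite -?addTb ?addbE; ring.

(** Adds a known relation to the goal modulo 2; after a chain of such additions only an identity for
    [bool_ring] is left. *)
Lemma addb_use (x y l r : bool) : x = y -> l (+) x = r (+) y -> l = r.
Proof. by move->; apply: addIb. Qed.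

(** Here [nr i j k] and [nb i j l] are to be the crossing parities of edge ij with the rays from red
    point k and blue point l. Each of them occurs in two of the 18 relations, because the other end
    of the second edge has two choices. On the right [rr] occurs an even number of times, [rb] and
    [br] cancel with an even number of ones, and there remain nine sums [bb j l (+) bb l j], each
    equal to 1. *)
Lemma K33_parity (nr nb : 'I_3 -> 'I_3 -> 'I_3 -> bool)
    (rr rb br bb : 'I_3 -> 'I_3 -> bool) :
  (forall i j, br j i = ~~ rb i j) ->
  (forall i j, i != j -> bb j i = ~~ bb i j) ->
  (forall i k j l, i != k -> j != l ->
     nr i j k (+) nb i j l (+) nr k l i (+) nb k l j =
     rr i k (+) rb i l (+) br j k (+) bb j l) -> False.
Proof.
move=> Hbr Hbb H.
pose o0 : 'I_3 := ord0; pose o1 : 'I_3 := inord 1; pose o2 : 'I_3 := ord_max.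
have n01 : o0 != o1 by rewrite -val_eqE /= inordK.
have n12 : o1 != o2 by rewrite -val_eqE /= inordK.
have n02 : o0 != o2 by [].
have n10 : o1 != o0 by rewrite eq_sym.
have n21 : o2 != o1 by rewrite eq_sym.
have n20 : o2 != o0 by [].
pose L i k j l := nr i j k (+) nb i j l (+) nr k l i (+) nb k l j.
pose Rs i k j l := rr i k (+) rb i l (+) br j k (+) bb j l.
pose T (F : 'I_3 -> 'I_3 -> 'I_3 -> 'I_3 -> bool) i k :=
  F i k o0 o1 (+) F i k o0 o2 (+) F i k o1 o0 (+) F i k o1 o2 (+) F i k o2 o0 (+) F i k o2 o1.
have : T L o0 o1 (+) T L o0 o2 (+) T L o1 o2 = T Rs o0 o1 (+) T Rs o0 o2 (+) T Rs o1 o2.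
  by rewrite /T /L /Rs !H.
have -> : T L o0 o1 (+) T L o0 o2 (+) T L o1 o2 = false.
  by rewrite /T /L; bool_ring.
have -> : T Rs o0 o1 (+) T Rs o0 o2 (+) T Rs o1 o2 = true.
  rewrite /T /Rs !Hbr (Hbb _ _ n01) (Hbb _ _ n02) (Hbb _ _ n12).
  by bool_ring.
by [].
Qed.

From mathcomp Require Import ring lra zify.

(** * Crossings of a path with a vertical ray *)

Section RayCrossing.
Variable R : realType.
Local Notation pt := (R * R)%type.
Implicit Types (u v w a b c d x y : pt) (s t : seq pt).

Lemma crossNN u w : cross (- u) (- w) = cross u w.
Proof. by rewrite /cross /= !mulrNN. Qed.

Lemma crossC u w : cross u w = - cross w u.
Proof. by rewrite /cross; ring. Qed.

(* The side of a vertical line through the origin, tilted infinitesimally so that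
   no nonzero vector lies on it. *)
Definition lexneg u := (u.1 < 0) || (u.1 == 0) && (u.2 < 0).

(* The segment [u w] meets the upper half of that line; junk if it contains 0. *)
Definition raycross u w :=
  if lexneg u then ~~ lexneg w && (0 < cross w u)
  else lexneg w && (0 < cross u w).

(** The weights are not normalised, so that they can be taken directly from coordinates and cross
    products. *)
Definition zero_in_hull u v w := exists al be ga : R,
  [/\ [/\ 0 <= al, 0 <= be & 0 <= ga], 0 < al + be + ga,
      al * u.1 + be * v.1 + ga * w.1 = 0
    & al * u.2 + be * v.2 + ga * w.2 = 0].

Lemma raycrossC u w : raycross u w = raycross w u.
Proof. by rewrite /raycross; case: (lexneg u); case: (lexneg w). Qed.

Lemma lexnegP u :
  if lexneg u then u.1 < 0 \/ u.1 = 0 /\ u.2 < 0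
  else 0 < u.1 \/ u.1 = 0 /\ 0 <= u.2.
Proof.
rewrite /lexneg; case: ltrgtP => //= h; [by left|by left|].
by case: ltP => h2; right.
Qed.

Lemma zero_in_hull_perm u v w : zero_in_hull u v w -> zero_in_hull v w u.
Proof.
move=> [al [be [ga [[h1 h2 h3] h4 h5 h6]]]]; exists be, ga, al.
by split=> //; lra.
Qed.

Lemma zero_in_hull_opp u v w :
  zero_in_hull (- u) (- v) (- w) -> zero_in_hull u v w.
Proof.
move=> [al [be [ga [[h1 h2 h3] h4 /= h5 h6]]]]; exists al, be, ga.
by split=> //; lra.
Qed.

Lemma lexnegN u : u <> 0 -> lexneg (- u) = ~~ lexneg u.
Proof.
case: u => x y nz; rewrite /lexneg /= !oppr_lt0 oppr_eq0.
case: (ltrgtP x 0) => //= hx; case: (ltrgtP y 0) => //= hy.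
by case: nz; rewrite hx hy.
Qed.

(** The line through 0 and [u] separates [v] from [w], so the combination [z = - q v + p w] lies on
    it, on the side opposite to [u]. The weights come from [z.1 u - u.1 z = 0]. *)
Lemma opposite_sides_hull u v w : lexneg u -> ~~ lexneg v -> ~~ lexneg w ->
  0 <= cross v u -> cross w u <= 0 -> 0 < cross v u - cross w u ->
  zero_in_hull u v w.
Proof.
move=> nu nv nw; move: (lexnegP u) (lexnegP v) (lexnegP w).
rewrite nu (negbTE nv) (negbTE nw) /cross.
case: u v w {nu nv nw} => u1 u2 [v1 v2] [w1 w2] /=.
set p := v1 * _ - _; set q := w1 * _ - _ => hu hv hw p0 q0 pq.
have v0 : 0 <= v1 by case: hv; lra.
have w0 : 0 <= w1 by case: hw; lra.
have pw0 : 0 <= p * w1 by apply: mulr_ge0.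
have qv0 : 0 <= (- q) * v1 by apply: mulr_ge0; lra.
have E : (- q * v1 + p * w1) * u2 = (- q * v2 + p * w2) * u1.
  by rewrite /p /q; ring.
case: hu => [u0|[u10 u20]].
  exists (- q * v1 + p * w1), (- u1 * - q), (- u1 * p); split => /=.
  - by split; [lra|apply: mulr_ge0; lra|apply: mulr_ge0; lra].
  - have : 0 < (- u1) * (p - q) by apply: mulr_gt0; lra.
    lra.
  - ring.
  - transitivity ((- q * v1 + p * w1) * u2 - (- q * v2 + p * w2) * u1); first ring.
    by rewrite E subrr.
(* When [u.1 = 0] the previous weights all vanish; second coordinates replace the first ones. *)
have z1 : - q * v1 + p * w1 = 0.
  move: E; rewrite u10 mulr0 => /eqP; rewrite mulf_eq0 => /orP[/eqP //|/eqP]; lra.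
have pw2 : 0 <= p * w2.
  have /eqP : p * w1 = 0 by lra.
  rewrite mulf_eq0 => /orP[/eqP ->|/eqP w10]; first by rewrite mul0r.
  by apply: mulr_ge0 => //; case: hw; lra.
have qv2 : 0 <= - q * v2.
  have /eqP : - q * v1 = 0 by lra.
  rewrite mulf_eq0 => /orP[/eqP ->|/eqP w10]; first by rewrite mul0r.
  by apply: mulr_ge0 => //; case: hv; lra.
exists (- q * v2 + p * w2), (- u2 * - q), (- u2 * p); split => /=.
- by split; [lra|apply: mulr_ge0; lra|apply: mulr_ge0; lra].
- have : 0 < (- u2) * (p - q) by apply: mulr_gt0; lra.
  lra.
- transitivity (- u2 * (- q * v1 + p * w1)); first by rewrite u10; ring.
  by rewrite z1 mulr0.
- ring.
Qed.

Lemma collinear_hull u w : lexneg u -> ~~ lexneg w -> cross w u = 0 ->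
  zero_in_hull u w w.
Proof.
move=> nu nw; move: (lexnegP u) (lexnegP w).
rewrite nu (negbTE nw) /cross.
case: u w {nu nw} => u1 u2 [w1 w2] /= hu hw E.
case: hu => [u0|[u10 u20]].
  exists w1, (- u1), 0; split => /=; [|by case: hw; lra|ring|by rewrite mul0r addr0 -[RHS]E; ring].
  by split; [case: hw; lra|lra|lra].
have w10 : w1 = 0.
  move: E; rewrite u10 mulr0 subr0 => /eqP; rewrite mulf_eq0 => /orP[/eqP //|/eqP]; lra.
exists w2, (- u2), 0; split => /=; [|by case: hw; lra|rewrite u10 w10; ring|ring].
by split; [case: hw; lra|lra|lra].
Qed.

(** If exactly one of the two segments from [u] met the ray, [v] and [w] would lie on different
    sides of the line through 0 and [u], and [opposite_sides_hull] would apply, after a reflection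
    through 0 if [u] is on the nonnegative side. *)
Lemma cross_sign_eq u v w : lexneg u != lexneg v -> lexneg u != lexneg w ->
  ~ zero_in_hull u v w -> raycross u v = raycross u w.
Proof.
move=> huv huw H.
have Hs : ~ zero_in_hull u w v.
  move=> [al [be [ga [[h1 h2 h3] h4 /= h5 h6]]]]; apply: H; exists al, ga, be.
  by split=> //; lra.
rewrite /raycross.
case nu: (lexneg u) huv huw; case nv: (lexneg v) => //; case nw: (lexneg w) => //= _ _.
  apply/idP/idP => h; rewrite ltNge; apply/negP => h2.
    by apply: H; apply: opposite_sides_hull; rewrite ?nu ?nv ?nw //; lra.
  by apply: Hs; apply: opposite_sides_hull; rewrite ?nu ?nv ?nw //; lra.
(* The reflection exchanges the two sides only for nonzero vectors. *)
have nz (x : pt) : x = u \/ x = v \/ x = w -> x <> 0.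
  move=> hx x0; apply: H; case: hx => [|[|]] E; move: x0; rewrite E => ->;
  [exists 1, 0, 0|exists 0, 1, 0|exists 0, 0, 1] => /=;
  by split; [split|..]; lra.
have [hu hv hw] : [/\ lexneg (- u), lexneg (- v) = false & lexneg (- w) = false].
  by rewrite !lexnegN ?nu ?nv ?nw //; apply: nz; auto.
apply/idP/idP => h; rewrite ltNge; apply/negP => h2.
  apply: Hs; apply: zero_in_hull_opp; apply: opposite_sides_hull; rewrite ?hv ?hw // ?crossNN.
  - by rewrite (crossC w); lra.
  - by rewrite (crossC v); lra.
  - by rewrite (crossC v) (crossC w); lra.
apply: H; apply: zero_in_hull_opp; apply: opposite_sides_hull; rewrite ?hv ?hw // ?crossNN.
- by rewrite (crossC v); lra.
- by rewrite (crossC w); lra.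
- by rewrite (crossC v) (crossC w); lra.
Qed.

(** Either all vertices are on one side and nothing is crossed, or one vertex is alone on its side
    and its two edges are crossed together by [cross_sign_eq]. *)
Lemma raycross_triangle u v w : ~ zero_in_hull u v w ->
  raycross u v (+) raycross v w (+) raycross w u = false.
Proof.
move=> H.
have Hv : ~ zero_in_hull v w u by move=> /zero_in_hull_perm /zero_in_hull_perm.
have Hw : ~ zero_in_hull w u v by move=> /zero_in_hull_perm.
have same x y : lexneg x = lexneg y -> raycross x y = false.
  by rewrite /raycross => ->; case: (lexneg y).
have [Euv|Nuv] := eqVneq (lexneg u) (lexneg v).
  rewrite (same u v) //=.
  have [Euw|Nuw] := eqVneq (lexneg u) (lexneg w).
    by rewrite (same v w) -?Euv // (same w u).
  rewrite raycrossC (cross_sign_eq _ _ Hw) ?addbb //.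
    by rewrite eq_sym.
  by rewrite eq_sym -Euv.
have [Euw|Nuw] := eqVneq (lexneg u) (lexneg w).
  rewrite (same w u) // addbF raycrossC (cross_sign_eq _ _ Hv) ?addbb //.
  - by rewrite -Euw eq_sym.
  - by rewrite eq_sym.
rewrite (raycrossC w) -(cross_sign_eq _ _ H) //.
rewrite (same v w) ?addbF ?addbb //.
by move: Nuv Nuw; do 3!case: lexneg.
Qed.

(** The differences of points of the two segments fill a parallelogram that misses 0. The diagonal
    from [a - c] to [b - d] cuts it into two triangles and is counted twice. *)
Lemma raycross_parallelogram a b c d :
  (forall x, seg a b x -> ~ seg c d x) ->
  raycross (a - c) (b - c) (+) raycross (a - d) (b - d) (+)
  raycross (a - c) (a - d) (+) raycross (b - c) (b - d) = false.
Proof.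
move=> dis.
have scale0 (k z : R) : z = 0 -> k * z = 0 by move->; rewrite mulr0.
have T1 : ~ zero_in_hull (a - c) (b - c) (b - d).
  move=> [al [be [ga [[h1 h2 h3] h4 h5 h6]]]].
  set S := al + be + ga in h4.
  have nS : S != 0 by rewrite gt_eqF.
  (* Collecting [a], [b], [c], [d] in the vanishing combination exhibits a common point of both
     segments. *)
  apply: (dis ((1 - (be + ga) / S) * a.1 + (be + ga) / S * b.1,
               (1 - (be + ga) / S) * a.2 + (be + ga) / S * b.2)).
    exists ((be + ga) / S); split => //; apply/andP; split.
      by apply: divr_ge0; lra.
    by rewrite ler_pdivrMr // /S; lra.
  exists (ga / S); split.
    apply/andP; split; first by apply: divr_ge0; lra.
    by rewrite ler_pdivrMr // /S; lra.
  move: h5 h6 => /= /(scale0 S^-1) h5 /(scale0 S^-1) h6.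
  congr (_, _); apply/eqP; rewrite -subr_eq0; apply/eqP.
    by rewrite -[RHS]h5 /S; field.
  by rewrite -[RHS]h6 /S; field.
have T2 : ~ zero_in_hull (a - c) (b - d) (a - d).
  move=> [al [be [ga [[h1 h2 h3] h4 h5 h6]]]].
  set S := al + be + ga in h4.
  have nS : S != 0 by rewrite gt_eqF.
  apply: (dis ((1 - be / S) * a.1 + be / S * b.1,
               (1 - be / S) * a.2 + be / S * b.2)).
    exists (be / S); split => //; apply/andP; split.
      by apply: divr_ge0; lra.
    by rewrite ler_pdivrMr // /S; lra.
  exists ((be + ga) / S); split.
    apply/andP; split; first by apply: divr_ge0; lra.
    by rewrite ler_pdivrMr // /S; lra.
  move: h5 h6 => /= /(scale0 S^-1) h5 /(scale0 S^-1) h6.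
  congr (_, _); apply/eqP; rewrite -subr_eq0; apply/eqP.
    by rewrite -[RHS]h5 /S; field.
  by rewrite -[RHS]h6 /S; field.
have := raycross_triangle T1; have := raycross_triangle T2.
rewrite (raycrossC (b - d) (a - d)) (raycrossC (a - d) (a - c)).
rewrite (raycrossC (b - d) (a - c)).
by do 5![case: raycross].
Qed.

(** The upward and downward rays from [x] together form the vertical line, which the segment crosses
    exactly when its ends are on different sides. *)
Lemma raycrossN a b x : ~ seg a b x ->
  raycross (a - x) (b - x) (+) raycross (x - a) (x - b) =
  lexneg (a - x) (+) lexneg (b - x).
Proof.
move=> nx.
have H : ~ zero_in_hull (a - x) (b - x) (b - x).
  move=> [al [be [ga [[h1 h2 h3] h4 h5 h6]]]]; apply: nx.
  set S := al + be + ga in h4.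
  have nS : S != 0 by rewrite gt_eqF.
  exists ((be + ga) / S); split.
    apply/andP; split; first by apply: divr_ge0; lra.
    by rewrite ler_pdivrMr // /S; lra.
  have scale0 (k z : R) : z = 0 -> k * z = 0 by move->; rewrite mulr0.
  move: h5 h6 => /= /(scale0 S^-1) h5 /(scale0 S^-1) h6.
  rewrite [LHS]surjective_pairing.
  congr (_, _); apply/esym/eqP; rewrite -subr_eq0; apply/eqP.
    by rewrite -[RHS]h5 /S; field.
  by rewrite -[RHS]h6 /S; field.
rewrite -(opprB a x) -(opprB b x); move: (a - x) (b - x) H => u w H {nx}.
have u0 : u <> 0.
  by move=> E; apply: H; exists 1, 0, 0; rewrite E /=; split; [split|..]; lra.
have w0 : w <> 0.
  by move=> E; apply: H; exists 0, 1, 0; rewrite E /=; split; [split|..]; lra.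
rewrite /raycross !lexnegN // !crossNN.
case nu: (lexneg u); case nw: (lexneg w) => //=.
  rewrite (crossC u) oppr_gt0; case: ltrgtP => // E; case: H.
  by apply: collinear_hull; rewrite ?nu ?nw.
rewrite (crossC w) oppr_gt0; case: ltrgtP => // E; case: H.
do 2!apply: zero_in_hull_perm.
have [al [be [ga [[h1 h2 h3] h4 h5 h6]]]] : zero_in_hull w u u.
  by apply: collinear_hull; rewrite ?nu ?nw.
exists al, 0, (be + ga); split; [split|..]; lra.
Qed.

(** Crossings, modulo 2, of the path with the upward ray from [v]. *)
Fixpoint path_parity v a s : bool :=
  if s is b :: s' then raycross (a - v) (b - v) (+) path_parity v b s'
  else false.

(* The same count for the downward ray from [v]. *)
Fixpoint path_parityN v a s : bool :=
  if s is b :: s' then raycross (v - a) (v - b) (+) path_parityN v b s'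
  else false.

Lemma ponpath_last a s : ponpath a s (last a s).
Proof. by elim: s a => //= b s IH a; right; apply: IH. Qed.

Lemma path_parityD v a s : ~ ponpath a s v ->
  path_parity v a s (+) path_parityN v a s =
  lexneg (a - v) (+) lexneg (last a s - v).
Proof.
elim: s a => [|b s IH] a /=; first by rewrite addbb.
move=> nv; rewrite addbACA raycrossN; last by move=> ?; apply: nv; left.
rewrite IH; last by move=> ?; apply: nv; right.
by rewrite addbA; do 3!case: lexneg.
Qed.

(** A strip of parallelograms, one for each edge of the second path; sides shared by neighbours
    cancel. *)
Lemma seg_path_parity a b c t : (forall x, seg a b x -> ~ ponpath c t x) ->
  raycross (a - c) (b - c) (+) raycross (a - last c t) (b - last c t) (+)
  path_parityN a c t (+) path_parityN b c t = false.
Proof.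
elim: t c => [|d t IH] c /= dis; first by rewrite addbb.
have := @raycross_parallelogram a b c d (fun x h1 h2 => dis x h1 (or_introl h2)).
have := IH d (fun x h1 h2 => dis x h1 (or_intror h2)).
by do 5!case: (raycross _ _); do 2!case: (path_parityN _ _ _).
Qed.

(** The strips stack up to the whole square of parameters, whose four sides remain. On two sides the
    second path is fixed at an end and the ray goes up; on the other two the first path is fixed,
    and the sign of the difference turns the ray down. *)
Lemma disjoint_path_parity a s c t :
  (forall x, ponpath a s x -> ~ ponpath c t x) ->
  path_parity c a s (+) path_parity (last c t) a s (+)
  path_parityN a c t (+) path_parityN (last a s) c t = false.
Proof.
elim: s a => [|b s IH] a /= dis; first by rewrite addbb.
have := @seg_path_parity a b c t (fun x h1 => dis x (or_introl h1)).
have := IH b (fun x h1 => dis x (or_intror h1)).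
by do 2!case: (raycross _ _); do 3!case: (path_parityN _ _ _);
   do 2!case: (path_parity _ _ _).
Qed.

End RayCrossing.

(** * Polygonal paths and geodesic distance *)

Section GeodesicDistance.
Variable R : realType.
Local Notation pt := (R * R)%type.
Implicit Types (a b c d x y : pt) (s t : seq pt) (P : set pt).

(** The infimum in [gdist] is meaningful only when some path exists. *)
Definition pconnected P a b := exists s, last a s = b /\ pinside P a s.

Lemma plen_ge0 a s : 0 <= plen a s.
Proof. by elim: s a => //= b s IH a; rewrite addr_ge0 // sqrtr_ge0. Qed.

Lemma gdist_le P a s : pinside P a s -> gdist P a (last a s) <= plen a s.
Proof.
move=> ins; apply: ge_inf; last by exists s.
by exists 0 => _ [t [_ _ ->]]; apply: plen_ge0.
Qed.

(** Supplies nearly shortest paths in place of geodesics. *)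
Lemma short_path P a b (l : R) : pconnected P a b -> gdist P a b < l ->
  exists s, [/\ last a s = b, pinside P a s & plen a s < l].
Proof.
move=> [s [ls ins]] lt_l.
have ne : [set l | exists s, [/\ last a s = b, pinside P a s & l = plen a s]] !=set0.
  by exists (plen a s), s.
by have [_ [t [lt it ->]] tl] := inf_lt ne lt_l; exists t.
Qed.

Lemma seg_subl a b x : seg a b x -> seg a x `<=` seg a b.
Proof.
move=> [t [/andP[t0 t1] ->]] _ [t' [/andP[t'0 t'1] ->]] /=.
exists (t' * t); split.
  by rewrite mulr_ge0 //= mulr_ile1.
by congr (_, _); ring.
Qed.

Lemma segC a b : seg a b = seg b a.
Proof.
suff H (u v : pt) : seg u v `<=` seg v u by apply/seteqP; split; apply: H.
move=> _ [t [/andP[t0 t1] ->]]; exists (1 - t); split; first by apply/andP; split; lra.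
by congr (_, _); ring.
Qed.

Lemma edist_seg a b x : seg a b x ->
  Defs.edist a x + Defs.edist x b = Defs.edist a b.
Proof.
move=> [t [/andP[t0 t1] ->]]; rewrite /Defs.edist /=.
set D := (a.1 - b.1) ^+ 2 + (a.2 - b.2) ^+ 2.
have -> : (a.1 - ((1 - t) * a.1 + t * b.1)) ^+ 2 +
  (a.2 - ((1 - t) * a.2 + t * b.2)) ^+ 2 = t ^+ 2 * D by rewrite /D; ring.
have -> : ((1 - t) * a.1 + t * b.1 - b.1) ^+ 2 +
  ((1 - t) * a.2 + t * b.2 - b.2) ^+ 2 = (1 - t) ^+ 2 * D by rewrite /D; ring.
rewrite (sqrtrM _ (sqr_ge0 t)) (sqrtrM _ (sqr_ge0 (1 - t))) !sqrtr_sqr.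
rewrite !ger0_norm; [ring|lra|lra].
Qed.

Lemma path_split P a s x : pinside P a s -> ponpath a s x ->
  exists s1 s2, [/\ last a s1 = x, last x s2 = last a s,
    pinside P a s1, pinside P x s2 & plen a s1 + plen x s2 = plen a s].
Proof.
elim: s a => [|b s IH] a /=; first by move=> _ ->; exists [::], [::]; split; rewrite //= addr0.
move=> [ab ins] [abx|/(IH _ ins)[s1 [s2 [e1 e2 i1 i2 l]]]].
  exists [:: x], (b :: s); split => //=.
  - by split => //; apply: subset_trans ab; apply: seg_subl.
  - split => //; apply: subset_trans ab; rewrite segC (segC a); apply: seg_subl.
    by rewrite segC.
  - by rewrite addr0 addrA edist_seg.
by exists (b :: s1), s2; split => //=; rewrite -addrA l.
Qed.

Lemma pinside_cat P a s t : pinside P a s -> pinside P (last a s) t ->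
  pinside P a (s ++ t).
Proof. by elim: s a => //= b s IH a [ab ins] int; split => //; apply: IH. Qed.

Lemma plen_cat a s t : plen a (s ++ t) = plen a s + plen (last a s) t.
Proof. by elim: s a => [|b s IH] a /=; rewrite ?add0r // IH addrA. Qed.

(* If the paths met, exchanging their tails would yield paths of the same
   total length from each start to the other's end. *)
Lemma short_paths_disjoint P a s c t :
  pinside P a s -> pinside P c t ->
  plen a s < gdist P a (last c t) -> plen c t < gdist P c (last a s) ->
  forall x, ponpath a s x -> ~ ponpath c t x.
Proof.
move=> ins int lts ltt x /(path_split ins)[s1 [s2 [e1 e2 i1 i2 ls]]].
move=> /(path_split int)[t1 [t2 [f1 f2 j1 j2 lt]]].
have h1 : gdist P a (last c t) <= plen a s1 + plen x t2.
  have -> : last c t = last a (s1 ++ t2) by rewrite last_cat e1.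
  rewrite -e1 -plen_cat; apply: gdist_le; apply: pinside_cat => //.
  by rewrite e1.
have h2 : gdist P c (last a s) <= plen c t1 + plen x s2.
  have -> : last a s = last c (t1 ++ s2) by rewrite last_cat f1.
  rewrite -f1 -plen_cat; apply: gdist_le; apply: pinside_cat => //.
  by rewrite f1.
lra.
Qed.

Lemma pconnected_refl P a : pconnected P a a.
Proof. by exists [::]. Qed.

Lemma pconnected_trans P a b c :
  pconnected P a b -> pconnected P b c -> pconnected P a c.
Proof.
move=> [s [<- ins]] [t [<- int]]; exists (s ++ t); split; first by rewrite last_cat.
exact: pinside_cat.
Qed.

Lemma pconnected_seg P a b : seg a b `<=` P -> pconnected P a b.
Proof. by move=> ab; exists [:: b]. Qed.

Lemma pconnected_sym P a b : pconnected P a b -> pconnected P b a.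
Proof.
move=> [s [<- {b}]]; elim: s a => [|b s IH] a /=; first by move=> _; apply: pconnected_refl.
move=> [ab /IH h]; apply: pconnected_trans h _.
by apply: pconnected_seg; rewrite segC.
Qed.

(** The edge is made of two legs from the centre [c]; modulo 2 their direction does not matter. *)
Definition edge_parity c s t v := path_parity v c s (+) path_parity v c t.

(** Summed over the four pairs of legs, the terms at the centres [c] and [c'] occur twice and
    cancel. Then [path_parityD] trades downward rays for upward ones at the cost of the [lexneg]
    terms. *)
Lemma disjoint_edge_parity c s t c' s' t' :
  (forall p q, p \in [:: s; t] -> q \in [:: s'; t'] ->
    forall x, ponpath c p x -> ~ ponpath c' q x) ->
  let r := last c s in let b := last c t in
  let r' := last c' s' in let b' := last c' t' in
  edge_parity c s t r' (+) edge_parity c s t b' (+)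
  edge_parity c' s' t' r (+) edge_parity c' s' t' b =
  lexneg (r' - r) (+) lexneg (b' - r) (+) lexneg (r' - b) (+) lexneg (b' - b).
Proof.
move=> dis /=.
have [is_ it] : s \in [:: s; t] /\ t \in [:: s; t] by rewrite !inE !eqxx orbT.
have [is' it'] : s' \in [:: s'; t'] /\ t' \in [:: s'; t'] by rewrite !inE !eqxx orbT.
have notin p q : p \in [:: s; t] -> q \in [:: s'; t'] -> ~ ponpath c' q (last c p).
  by move=> hp hq; apply: (dis p q) => //; apply: ponpath_last.
rewrite /edge_parity.
apply: (addb_use (disjoint_path_parity (dis s s' is_ is'))).
apply: (addb_use (disjoint_path_parity (dis s t' is_ it'))).
apply: (addb_use (disjoint_path_parity (dis t s' it is'))).
apply: (addb_use (disjoint_path_parity (dis t t' it it'))).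
apply: (addb_use (path_parityD (notin s s' is_ is'))).
apply: (addb_use (path_parityD (notin s t' is_ it'))).
apply: (addb_use (path_parityD (notin t s' it is'))).
apply: (addb_use (path_parityD (notin t t' it it'))).
bool_ring.
Qed.
End GeodesicDistance.

(** * Drawing of K_{3,3} by nearly shortest paths *)

Section K33.
Variable R : realType.
Local Notation pt := (R * R)%type.

Lemma lt_common_bound (x : R) (s : seq R) : {in s, forall y, x < y} ->
  exists2 l, x < l & {in s, forall y, l <= y}.
Proof.
elim: s => [|y s IH] hs; first by exists (x + 1); [lra|].
have [|l xl ls] := IH; first by move=> z zs; apply: hs; rewrite inE zs orbT.
exists (Num.min y l); first by rewrite lt_min xl hs ?inE ?eqxx.
move=> z; rewrite inE => /orP[/eqP ->|/ls lz]; rewrite ge_min ?lexx //.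
by rewrite lz orbT.
Qed.

Lemma K33_not_all_empty (P : set pt) (r b : 'I_3 -> pt) (c : 'I_3 -> 'I_3 -> pt) :
  (forall i j, pconnected P (c i j) (r i)) ->
  (forall i j, pconnected P (c i j) (b j)) ->
  (forall i j, gdist P (c i j) (r i) = gdist P (c i j) (b j)) ->
  (forall i j k, k != i -> gdist P (c i j) (r i) < gdist P (c i j) (r k)) ->
  (forall i j k, k != j -> gdist P (c i j) (b j) < gdist P (c i j) (b k)) ->
  False.
Proof.
move=> cr cb eqd ltr ltb.
have paths i j : exists st : seq pt * seq pt,
    [/\ last (c i j) st.1 = r i, last (c i j) st.2 = b j,
        pinside P (c i j) st.1, pinside P (c i j) st.2
      & forall p k l, p \in [:: st.1; st.2] -> k != i -> l != j ->
          plen (c i j) p < gdist P (c i j) (r k) /\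
          plen (c i j) p < gdist P (c i j) (b l)].
  (* A bound [l] above the radius and at most the distances to the other four points: legs shorter
     than [l] permit the tail exchange. *)
  have [|l dl lle] := @lt_common_bound (gdist P (c i j) (r i))
    ([seq gdist P (c i j) (r k) | k <- enum 'I_3 & k != i] ++
     [seq gdist P (c i j) (b k) | k <- enum 'I_3 & k != j]).
    move=> y; rewrite mem_cat => /orP[]/mapP[k]; rewrite mem_filter => /andP[hk _] ->.
      exact: ltr.
    by rewrite eqd; apply: ltb.
  have [s [ls ins lens]] := short_path (cr i j) dl.
  have [t [lt int lent]] : exists t, [/\ last (c i j) t = b j, pinside P (c i j) t
      & plen (c i j) t < l].
    by apply: short_path => //; rewrite -eqd.
  exists (s, t); split => // p k m /= hp hk hm.
  have pl : plen (c i j) p < l by move: hp; rewrite !inE => /orP[]/eqP ->.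
  split; apply: lt_le_trans pl _; apply: lle; rewrite mem_cat; apply/orP.
    by left; apply/mapP; exists k; rewrite // mem_filter hk mem_enum.
  by right; apply/mapP; exists m; rewrite // mem_filter hm mem_enum.
pose S i j := (projT1 (cid (paths i j))).1.
pose T i j := (projT1 (cid (paths i j))).2.
have lS i j : last (c i j) (S i j) = r i by rewrite /S; case: cid => ? [].
have lT i j : last (c i j) (T i j) = b j by rewrite /T; case: cid => ? [].
have shortST i j p k l : p \in [:: S i j; T i j] -> k != i -> l != j ->
    [/\ pinside P (c i j) p, plen (c i j) p < gdist P (c i j) (r k) &
        plen (c i j) p < gdist P (c i j) (b l)].
  rewrite /S /T; case: cid => -[s t] [/= _ _ ins int H] hp hk hl.
  have [h1 h2] := H _ _ _ hp hk hl; split => //.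
  by move: hp; rewrite !inE => /orP[]/eqP ->.
have dis i k j l : i != k -> j != l -> forall p q,
    p \in [:: S i j; T i j] -> q \in [:: S k l; T k l] ->
    forall x, ponpath (c i j) p x -> ~ ponpath (c k l) q x.
  move=> ik jl p q hp hq.
  have ki : k != i by rewrite eq_sym.
  have lj : l != j by rewrite eq_sym.
  have [ip pr pb] := shortST i j p k l hp ki lj.
  have [iq qr qb] := shortST k l q i j hq ik jl.
  apply: short_paths_disjoint ip iq _ _.
    by move: hq; rewrite !inE => /orP[]/eqP ->; rewrite ?lS ?lT.
  by move: hp; rewrite !inE => /orP[]/eqP ->; rewrite ?lS ?lT.
(* For [k] other than [j], the disk of [i] and [k] passes through [r i] but excludes [b j].
   Distinctness makes [lexneg] of a difference change under swapping. *)
have rneb i j : r i <> b j.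
  pose k : 'I_3 := if j == ord0 then ord_max else ord0.
  have jk : j != k by rewrite /k; have [->|] := eqVneq j ord0.
  by move=> E; have := ltb i k j jk; rewrite -eqd E ltxx.
have bneb i j : i != j -> b i <> b j.
  by move=> ij E; have := ltb ord0 j i ij; rewrite E ltxx.
have oppE (x y : pt) : x <> y -> lexneg (y - x) = ~~ lexneg (x - y).
  by move=> xy; rewrite -lexnegN ?opprB // => /eqP; rewrite subr_eq0 => /eqP.
apply: (@K33_parity
  (fun i j k => edge_parity (c i j) (S i j) (T i j) (r k))
  (fun i j k => edge_parity (c i j) (S i j) (T i j) (b k))
  (fun i k => lexneg (r k - r i)) (fun i l => lexneg (b l - r i))
  (fun j k => lexneg (r k - b j)) (fun j l => lexneg (b l - b j))).
- by move=> i j; apply: oppE => E; apply: (rneb i j).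
- by move=> i j ij; apply: oppE => E; apply: (bneb i j ij).
- move=> i k j l ik jl.
  have := disjoint_edge_parity (dis i k j l ik jl).
  by rewrite /= !lS !lT.
Qed.

End K33.

(** * Polygonal connectedness of the region *)

Section Region.
Variable R : realType.
Local Notation pt := (R * R)%type.
Implicit Types (a b x y : pt) (vs : seq pt).

Lemma continuous_pair (g h : R -> R) : continuous g -> continuous h ->
  continuous (fun t => (g t, h t) : pt).
Proof. by move=> cg ch t; exact: (cvg_pair (cg t) (ch t)). Qed.

Lemma continuous_horizontal x : continuous (fun t : R => (x.1 + t, x.2) : pt).
Proof.
apply: continuous_pair => t; last exact: cvg_cst.
by apply: cvgD; [exact: cvg_cst|exact: cvg_id].
Qed.

Lemma seg_closed a b : closed (seg a b).
Proof.
pose f (t : R) : pt := ((1 - t) * a.1 + t * b.1, (1 - t) * a.2 + t * b.2).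
have -> : seg a b = f @` `[0, 1].
  apply/seteqP; split=> [p [t [t01 ->]]|_ [t /= t01 <-]].
    by exists t => //; rewrite /= in_itv.
  by exists t; split => //; move: t01; rewrite in_itv.
apply: compact_closed; first exact: norm_hausdorff.
apply: continuous_compact; last exact: segment_compact.
have affine (p q : R) : continuous (fun t : R => (1 - t) * p + t * q : R).
  move=> t; apply: cvgD; apply: cvgM; try exact: cvg_cst; last exact: cvg_id.
  by apply: cvgB; [exact: cvg_cst|exact: cvg_id].
exact: continuous_subspaceT (continuous_pair (affine _ _) (affine _ _)).
Qed.

Lemma boundary_closed vs : closed (boundary vs).
Proof.
by apply: closed_bigcup; [exact: finite_II|move=> i _; exact: seg_closed].
Qed.

Lemma boundary_region vs : boundary vs `<=` region vs.
Proof. by move=> x bx []. Qed.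

Lemma component_region vs x y : region vs x ->
  connected_component (~` boundary vs) x y -> region vs y.
Proof.
move=> rx xy [_ uy]; apply: rx; split; last by rewrite (same_connected_component xy).
by move=> bx; move: xy; rewrite connected_component_out //; apply.
Qed.

Lemma connected_horizontal x (I : set R) : is_interval I ->
  connected [set (x.1 + t, x.2) | t in I].
Proof.
move=> itvI; apply: connected_continuous_connected; first exact/connected_intervalP.
by apply: continuous_subspaceT; apply: continuous_horizontal.
Qed.

(** Walk horizontally to the right. A ray missing the boundary would put [x] in an unbounded
    component; otherwise closedness gives a first hit, and the stretch before it stays in the
    component of [x]. *)
Lemma region_to_boundary vs x : region vs x ->
  exists2 y, boundary vs y & pconnected (region vs) x y.
Proof.
move=> rx; have [bx|nbx] := pselect (boundary vs x).
  by exists x => //; apply: pconnected_refl.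
pose f (t : R) : pt := (x.1 + t, x.2).
have f0 : f 0 = x by rewrite /f addr0 -surjective_pairing.
pose T := [set t : R | 0 <= t /\ boundary vs (f t)].
have lbT : lbound T 0 by move=> t [].
have T0 : T !=set0.
  apply/set0P/negP => /eqP T0; apply: rx; split => // M.
  (* Chosen so that the abscissa [x.1 + t] exceeds [M] in absolute value. *)
  pose t := `|M| + `|x.1| + 1.
  have t0 : 0 <= t by rewrite /t; have := normr_ge0 M; have := normr_ge0 x.1; lra.
  exists (f t); split.
    apply: (connected_component_max (B := f @` [set t | 0 <= t])).
    - by exists 0; [exact: lexx|exact: f0].
    - by move=> _ [u /= u0 <-] bu; suff : T u by rewrite T0.
    - by apply: connected_horizontal => u v /= u0 v0 w /andP[uw _]; apply: le_trans uw.
    - by exists t.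
  rewrite /f /=.
  have h1 : t <= `|x.1 + t| + `|x.1|.
    rewrite -{1}(ger0_norm t0); apply: le_trans (ler_normB _ _).
    by have -> : x.1 + t - x.1 = t by ring.
  by rewrite /t in h1 *; have := ler_norm M; have := normr_ge0 x.2; lra.
pose t0 := inf T.
have t00 : 0 <= t0 by apply: lb_le_inf.
have bt0 : boundary vs (f t0).
  apply: contrapT => nb.
  have : nbhs t0 (f @^-1` (~` boundary vs)).
    apply: continuous_horizontal; apply: open_nbhs_nbhs; split => //.
    by apply: closed_openC; apply: boundary_closed.
  move=> /nbhs_ballP[e /= e0 sube].
  have [t [tge bt] tlt] := @inf_lt _ T (t0 + e) T0 ltac:(rewrite -/t0; lra).
  apply: (sube t) => //.
  have t0t : t0 <= t by apply: ge_inf; [exists 0|].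
  by rewrite /ball /= ltr_distl; apply/andP; split; lra.
exists (f t0) => //; apply: pconnected_seg => y [k [/andP[k0 k1] ->]].
have -> : ((1 - k) * x.1 + k * (f t0).1, (1 - k) * x.2 + k * (f t0).2) = f (k * t0).
  by rewrite /f /=; congr (_, _); ring.
have [Ek|Nk] := eqVneq (k * t0) t0; first by rewrite Ek; apply: boundary_region.
have klt : k * t0 < t0 by rewrite lt_neqAle Nk /= ler_piMl.
apply: (component_region rx).
apply: (connected_component_max (B := f @` [set t | 0 <= t < t0])).
- exists 0 => //=; rewrite lexx /=; apply: le_lt_trans klt; exact: mulr_ge0.
- move=> _ [u /= /andP[u0 ut] <-] bu.
  have : t0 <= u by apply: ge_inf; [exists 0|].
  lra.
- apply: connected_horizontal => u v /= /andP[u0 _] /andP[_ vt] w /andP[uw wv].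
  by apply/andP; split; lra.
- by exists (k * t0) => //=; rewrite mulr_ge0.
Qed.

(** Each point is led to the boundary, then along the edges to vertex 0. *)
Lemma region_pconnected vs x y : (0 < size vs)%N -> region vs x -> region vs y ->
  pconnected (region vs) x y.
Proof.
move=> vs0.
have edge_sub i : (i < size vs)%N -> edge vs i `<=` region vs.
  by move=> iv; apply: subset_trans (@boundary_region vs); apply: bigcup_sup.
have vtx0 i : (i < size vs)%N -> pconnected (region vs) (vtx vs 0) (vtx vs i).
  elim: i => [_|i IH iv]; first exact: pconnected_refl.
  apply: pconnected_trans (IH (ltnW iv)) _; apply: pconnected_seg.
  exact: edge_sub (ltnW iv).
suff H z : region vs z -> pconnected (region vs) (vtx vs 0) z.
  by move=> rx ry; apply: pconnected_trans (H y ry); apply: pconnected_sym; apply: H.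
move=> /region_to_boundary[w [i /= iv iw] zw].
apply: pconnected_trans (vtx0 _ iv) _.
apply: pconnected_trans (pconnected_sym zw); apply: pconnected_seg.
by apply: subset_trans (edge_sub i iv); apply: seg_subl.
Qed.

End Region.

(** * Averaging over triples *)

Section Averaging.
Local Open Scope nat_scope.
Variable m : nat.
Implicit Types a : 'I_3.
Local Notation trip := {ffun 'I_3 -> 'I_m}.

(** Prescribing two values leaves one free, hence at most [m] triples for each pair. *)
Lemma sum_ffun_eval2 (F : 'I_m -> 'I_m -> nat) a a' : a != a' ->
  \sum_(f : trip) F (f a) (f a') <= m * \sum_i \sum_k F i k.
Proof.
move=> naa.
have [a2 third] : exists a2 : 'I_3, forall c : 'I_3, [|| c == a, c == a' | c == a2].
  move: naa; rewrite -val_eqE /= => naa.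
  (* The three indices 0, 1, 2 add up to 3. *)
  exists (inord (3 - a - a')) => c; rewrite -!val_eqE /= inordK; last by lia.
  by have := ltn_ord c; have := ltn_ord a; have := ltn_ord a'; lia.
rewrite pair_big /= (partition_big (fun f : trip => (f a, f a')) predT) //=.
rewrite big_distrr /=; apply: leq_sum => -[i k] _ /=.
rewrite (eq_bigr (fun=> F i k)); last by move=> f /eqP[-> ->].
rewrite sum_nat_const leq_mul2r; apply/orP; right.
rewrite -[X in _ <= X]card_ord; apply: (@leq_card_in _ _ (fun f : trip => f a2)).
move=> f g; rewrite !unfold_in /= => /andP[/eqP fi /eqP fk] /andP[/eqP gi /eqP gk] fg.
by apply/ffunP => c; case/or3P: (third c) => /eqP ->; rewrite ?fi ?fk.
Qed.

Lemma sum_ffun_eval1 (F : 'I_m -> nat) a :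
  \sum_(f : trip) F (f a) <= m ^ 2 * \sum_i F i.
Proof.
have [a' naa] : exists a', a != a'.
  exists (if a == ord0 then ord_max else ord0).
  by have [->|] := eqVneq a ord0.
apply: leq_trans (sum_ffun_eval2 (fun i _ => F i) naa) _.
under eq_bigr do rewrite sum_nat_const card_ord.
by rewrite -big_distrr /= mulnA mulnn.
Qed.

(* First moment: each of the 27 conditions of either kind fails for at most
   [m ^ 3] times the number of incidences among the [m ^ 6] pairs [(f, g)]. *)
Lemma exists_avoiding_triples (A B : 'I_m -> 'I_m -> 'I_m -> bool) d :
  (forall i j, \sum_k A i j k + \sum_k B i j k <= d) -> 27 * d < m ->
  exists f g : trip,
    (forall a b k, k != a -> ~~ A (f a) (g b) (f k)) /\
    (forall a b k, k != b -> ~~ B (f a) (g b) (g k)).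
Proof.
move=> Hd dm; apply: contrapT => none.
pose idx := ('I_3 * 'I_3 * 'I_3)%type.
pose XA (t : idx) (p : trip * trip) : nat := A (p.1 t.1.1) (p.2 t.1.2) (p.1 t.2).
pose XB (t : idx) (p : trip * trip) : nat := B (p.1 t.1.1) (p.2 t.1.2) (p.2 t.2).
pose VA p := \sum_(t : idx | t.2 != t.1.1) XA t p.
pose VB p := \sum_(t : idx | t.2 != t.1.2) XB t p.
have pos p : 0 < VA p + VB p.
  rewrite lt0n; apply/negP; rewrite addn_eq0 => /andP[/eqP VA0 /eqP VB0].
  apply: none; exists p.1, p.2; split => a b k nk; apply/negP => h.
    by move: VA0; rewrite /VA (bigD1 (a, b, k)) //= /XA /= h.
  by move: VB0; rewrite /VB (bigD1 (a, b, k)) //= /XB /= h.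
have sum27 (Q : pred idx) X W : (forall t, Q t -> \sum_p X t p <= W) ->
    \sum_(p : trip * trip) \sum_(t | Q t) X t p <= 27 * W.
  move=> oneW; rewrite exchange_big /=.
  apply: (@leq_trans (\sum_(t | Q t) W)); first by apply: leq_sum => t; apply: oneW.
  rewrite sum_nat_const leq_mul2r; apply/orP; right.
  by apply: leq_trans (max_card _) _; rewrite !card_prod card_ord.
have sumA : \sum_p VA p <= 27 * (m ^ 3 * \sum_i \sum_j \sum_k A i j k).
  apply: sum27 => -[[a b] k] /= nk.
  (* Two values of [f] and one of [g] are prescribed, which leaves [m * m ^ 2] pairs. *)
  rewrite -(pair_bigA _ (fun f g : trip => A (f a) (g b) (f k) : nat)) /=.
  apply: (@leq_trans (\sum_(f : trip) m ^ 2 * \sum_j A (f a) j (f k))).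
    by apply: leq_sum => f _; apply: (sum_ffun_eval1 (fun j => A (f a) j (f k) : nat)).
  rewrite -big_distrr /= (expnSr m 2) -mulnA leq_mul2l; apply/orP; right.
  under [X in _ <= _ * X]eq_bigr do rewrite exchange_big /=.
  by apply: (sum_ffun_eval2 (fun i k => \sum_j A i j k)); rewrite eq_sym.
have sumB : \sum_p VB p <= 27 * (m ^ 3 * \sum_i \sum_j \sum_k B i j k).
  apply: sum27 => -[[a b] k] /= nk.
  rewrite -(pair_bigA _ (fun f g : trip => B (f a) (g b) (g k) : nat)) /=.
  rewrite exchange_big /=.
  apply: (@leq_trans (\sum_(g : trip) m ^ 2 * \sum_i B i (g b) (g k))).
    by apply: leq_sum => g _; apply: (sum_ffun_eval1 (fun i => B i (g b) (g k) : nat)).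
  rewrite -big_distrr /= (expnSr m 2) -mulnA leq_mul2l; apply/orP; right.
  rewrite [X in _ <= _ * X]exchange_big /=.
  under [X in _ <= _ * X]eq_bigr do rewrite exchange_big /=.
  by apply: (sum_ffun_eval2 (fun j k => \sum_i B i j k)); rewrite eq_sym.
have total : m ^ 6 <= \sum_p VA p + \sum_p VB p.
  rewrite -big_split /=; apply: (@leq_trans (\sum_(p : trip * trip) 1)).
    by rewrite sum_nat_const card_prod !card_ffun !card_ord muln1 -expnD.
  by apply: leq_sum => p _; apply: pos.
have bound : \sum_i \sum_j \sum_k A i j k + \sum_i \sum_j \sum_k B i j k <= m ^ 2 * d.
  rewrite -big_split /=.
  under eq_bigr do rewrite -big_split /=.
  apply: (@leq_trans (\sum_(i < m) \sum_(j < m) d)).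
    by do 2!(apply: leq_sum => ? _); apply: Hd.
  by rewrite !sum_nat_const card_ord mulnA mulnn.
have m0 : 0 < m ^ 5 by rewrite expn_gt0; apply/orP; left; lia.
have : m ^ 6 <= m ^ 5 * (27 * d).
  apply: leq_trans total _; apply: leq_trans (leq_add sumA sumB) _.
  rewrite -!mulnDr [X in _ <= X]mulnCA leq_mul2l /=.
  by rewrite (expnD m 3 2) -mulnA leq_mul2l bound orbT.
by rewrite (expnSr m 5) leq_pmul2l // leqNgt dm.
Qed.

Lemma count_sum_nth (T : Type) (x0 : T) (p : pred T) s :
  count p s = \sum_(k < size s) p (nth x0 s k).
Proof. by rewrite -sum1_count big_mkcond (big_nth x0) big_mkord; apply: eq_bigr. Qed.

End Averaging.

(** * From sparse disks to six points with empty disks *)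

Theorem theorem8 (R : realType) (n : nat) (vs red blue : seq (R * R)) :
  ~~ odd n -> (6 <= n)%N ->
  simple_polygon vs ->
  size red = n./2 -> size blue = n./2 ->
  uniq (red ++ blue) ->
  (forall s, s \in red ++ blue -> region vs s) ->
  general_position vs (red ++ blue) ->
  exists r b, [/\ r \in red, b \in blue &
    forall (c : R * R) (rho : R), region vs c ->
      gdist (region vs) c r = rho -> gdist (region vs) c b = rho ->
      Num.ceil ((n%:R - 2) / 72 : R) <= (disk_count vs (red ++ blue) c rho)%:Z].
Proof.
move=> evn n6 [vs3 _ _] sr sb _ inP _.
set m := n./2 in sr sb; have nm : n = (m * 2)%N by rewrite muln2 even_halfK.
have m3 : (3 <= m)%N by lia.
apply: contrapT => none.
pose r (i : 'I_m) := nth (0, 0) red i.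
pose b (i : 'I_m) := nth (0, 0) blue i.
have rin i : r i \in red by rewrite mem_nth // sr.
have bin i : b i \in blue by rewrite mem_nth // sb.
set P := region vs.
have sparse i j : exists c, [/\ P c, gdist P c (r i) = gdist P c (b j) &
    (36 * disk_count vs (red ++ blue) c (gdist P c (r i)) <= m)%N].
  apply: contrapT => H; apply: none; exists (r i), (b j); split => // c rho Pc cr cb.
  (* A count below the ceiling is below [(n - 2) / 72] itself, and [n = 2 m] gives 36 times the
     count below [m - 1]. *)
  rewrite leNgt; apply/negP; rewrite ceil_gt_int => lt_cnt; apply: H; exists c.
  split; rewrite ?cr ?cb // -(ler_nat R) natrM.
  move: lt_cnt; rewrite -pmulrn nm natrM -/P; lra.
pose c i j := projT1 (cid (sparse i j)).
have Pc i j : P (c i j) by rewrite /c; case: cid => ? [].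
have eqd i j : gdist P (c i j) (r i) = gdist P (c i j) (b j).
  by rewrite /c; case: cid => ? [].
have cnt i j : (36 * disk_count vs (red ++ blue) (c i j) (gdist P (c i j) (r i)) <= m)%N.
  by rewrite /c; case: cid => ? [].
(* The incidences include [r i] and [b j] themselves, so a triple with a repeated point violates its
   own conditions; thus [f] and [g] are injective. *)
have [|//|f [g [nA nB]]] := @exists_avoiding_triples m
  (fun i j k => gdist P (c i j) (r k) <= gdist P (c i j) (r i))
  (fun i j k => gdist P (c i j) (b k) <= gdist P (c i j) (r i)) (m %/ 36).
- move=> i j; rewrite leq_divRL // mulnC; apply: leq_trans (cnt i j).
  rewrite /disk_count count_cat !(count_sum_nth (0, 0)) sr sb.
  exact: leqnn.
- by lia.
apply: (@K33_not_all_empty R P (r \o f) (b \o g) (fun i j => c (f i) (g j))) => /=.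
- move=> i j; apply: region_pconnected; [by lia|exact: Pc|apply: inP].
  by rewrite mem_cat rin.
- move=> i j; apply: region_pconnected; [by lia|exact: Pc|apply: inP].
  by rewrite mem_cat bin orbT.
- by move=> i j; apply: eqd.
- by move=> i j k ki; rewrite ltNge; apply: nA.
- by move=> i j k kj; rewrite -eqd ltNge; apply: nB.
Qed.
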